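(* For integers $l\ge 1$ and $m\ge 1$, let $X_{l,m}$ be the random variable with $P[X_{l,m}=n]=\frac{h_{l,m}(n)}{\sum_{i=0}^{lm}h_{l,m}(i)}$ for $0\le n\le lm$, where $h_{l,m}(n)$ is the number of tuples $(\pi_1,\dots,\pi_k)$ with $1\le k\le m$ and integers $0\le \pi_j\le l$ such that $\pi_1+\dots+\pi_k=n$. Let $\sigma_l^2=\frac{(l+1)^2-1}{12}$. Then \[ \frac{X_{l,m}-\frac{ml}{2}}{\sigma_l\sqrt{m}} \] converges in distribution to the standard normal distribution $\mathcal{N}(0,1)$ as $l,m\to\infty$.
   Context: An integer composition of a nonnegative integer $n$ into $k$ parts is a tuple $(\pi_1,\dots,\pi_k)$ of nonnegative integers with $\pi_1+\dots+\pi_k=n$. The count $h_{l,m}(n)$ (compositions of $n$ with at most $m$ parts, each of size between $0$ and $l$) is, as in the paper, taken over compositions with between $1$ and $m$ parts. The total $\sum_{i=0}^{lm}h_{l,m}(i)$ is positive, so $X_{l,m}$ is well defined. *)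

(* Defs.v *)
From HB Require Import structures.
From mathcomp Require Import all_boot all_order all_algebra.
From mathcomp Require Import all_classical all_reals all_analysis.
From mathcomp Require Import measurable_realfun.

Set Implicit Arguments.
Unset Strict Implicit.
Unset Printing Implicit Defensive.

Import Order.TTheory GRing.Theory Num.Theory.
Import numFieldNormedType.Exports.

Local Open Scope classical_set_scope.
Local Open Scope ring_scope.

(* A k.-tuple over 'I_l.+1 is a tuple of k parts, each between 0 and l;
   tuples with different numbers of parts are counted separately. *)
Definition num_compositions (l m n : nat) : nat :=
  (\sum_(1 <= k < m.+1)
     #|[pred p : k.-tuple 'I_l.+1 | \sum_(j < k) tnth p j == n]|)%N.

(* The standard deviation of the uniform distribution on {0, ..., l}. *)
Definition sigma {R : realType} (l : nat) : R :=
  Num.sqrt ((l.+1%:R ^+ 2 - 1) / 12).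

Definition standardize {T : Type} {R : realType} (X : T -> R) (a s : R) :
  T -> R := fun w => (X w - a) / s.

Section standardize_measurable.
Context d (T : measurableType d) (R : realType) (X : {mfun T >-> R}) (a s : R).

Let measurable_standardize : measurable_fun setT (standardize X a s).
Proof.
apply: measurable_funM; last exact: measurable_cst.
by apply: measurable_funB; [exact: measurable_funPT|exact: measurable_cst].
Qed.

HB.instance Definition _ :=
  isMeasurableFun.Build _ _ _ _ (standardize X a s) measurable_standardize.

End standardize_measurable.

(* The variables X i may live on different probability spaces. Only continuity
   points of the limiting distribution function are tested, and the index
   i tends to its limit along an arbitrary filter F. The type measurableTypeR R
   is the real line with its Borel sets. *)
Definition cvg_in_distribution {I : Type} (F : set_system I)
    (d : I -> measure_display) (T : forall i, measurableType (d i))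
    (R : realType) (P : forall i, probability (T i) R)
    (X : forall i, {RV (P i) >-> R})
    (mu : probability (measurableTypeR R) R) : Prop :=
  forall x : R, {for x, continuous (fun r : R => mu `]-oo, r]%classic)} ->
    cdf (X i) x @[i --> F] --> mu `]-oo, x]%classic.

(* Main.v *)
(* Compositions with fewer than m parts are a fraction at most 1/l of all, so
   up to this error X is the sum of m independent uniform parts. For that sum,
   Lindeberg's replacement argument is run on the test functions
   w |-> Phi((y - w) / sqrt t), which are Gaussian smoothings of indicators of
   half-lines. They solve the heat equation in t, so adding one part of
   variance h to w while lowering t by h changes the expectation by O(h^(3/2)),
   with explicit derivatives of Phi as the only input: no Gaussian summand and
   no convolution is needed. The m steps with h = 1/m turn variance eps into
   1 + eps with total error O(m^(-1/2)), and eps -> 0 removes the smoothing. *)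

Require Import Defs.
From HB Require Import structures.
From mathcomp Require Import all_boot all_order all_algebra.
From mathcomp Require Import all_classical all_reals all_analysis.
From mathcomp Require Import measurable_realfun ring lra.

Set Implicit Arguments.
Unset Strict Implicit.
Unset Printing Implicit Defensive.

Import Order.TTheory GRing.Theory Num.Theory.
Import numFieldNormedType.Exports.

Local Open Scope classical_set_scope.
Local Open Scope ring_scope.

(** * Derivatives and Taylor bounds for the standard normal distribution *)

Section std_normal.
Context {R : realType}.
Implicit Types x y z d : R.

Definition std_pdf x : R := normal_peak 1 * expR (- (x ^+ 2 / 2)).

Definition std_cdf x : R := fine (normal_prob 0 1 `]-oo, x]%classic).

Lemma normal_pdf01E : normal_pdf 0 1 = std_pdf.
Proof.
rewrite normal_pdfE ?oner_neq0//; apply/funext => x.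
by rewrite /normal_fun subr0 expr1n mulNr.
Qed.

Lemma std_pdf_ge0 x : 0 <= std_pdf x.
Proof. by rewrite mulr_ge0 ?normal_peak_ge0 ?expR_ge0. Qed.

Lemma is_derive_std_cdf x : is_derive x 1 std_cdf (std_pdf x).
Proof.
have -> : std_cdf =
    fun y => (\int[lebesgue_measure]_(t in [set` `]-oo, y]])
                normal_pdf 0 1 t)%R.
  by [].
rewrite -normal_pdf01E.
(* The right endpoint [x + 1] makes [x] an interior point of the interval of integration. *)
have [||//||+ <-] :=
  @continuous_FTC1 R (normal_pdf 0 1) -oo%O x (x + 1).
- by rewrite ltrDl.
- by apply: integrableS (integrable_normal_pdf 0 1).
- by rewrite ltNyr.
- by apply: continuous_normal_pdf; rewrite oner_neq0.
by rewrite derive1E => ?; exact: derivableP.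
Qed.

Lemma std_cdfE x : normal_prob 0 1 `]-oo, x]%classic = (std_cdf x)%:E.
Proof. by rewrite /std_cdf fineK// fin_num_measure. Qed.

Lemma std_cdf_ge0 x : 0 <= std_cdf x.
Proof. by rewrite fine_ge0. Qed.

Lemma std_cdf_le1 x : std_cdf x <= 1.
Proof. by rewrite -lee_fin -std_cdfE probability_le1. Qed.

Lemma std_cdf_nd : {homo std_cdf : x y / x <= y}.
Proof.
move=> x y xy; rewrite -lee_fin -!std_cdfE le_measure ?inE//.
by apply: subset_itvl; rewrite bnd_simp.
Qed.

Lemma continuous_std_cdf : continuous std_cdf.
Proof.
move=> x; apply/differentiable_continuous/derivable1_diffP.
by have [] := is_derive_std_cdf x.
Qed.

Lemma is_derive_std_pdf x : is_derive x 1 std_pdf (- x * std_pdf x).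
Proof.
have D : is_derive x 1 (fun x : R => - (x ^+ 2 / 2)) (- x).
  apply: is_derive_eq; rewrite /GRing.scale/= !mulr1 !mulr0 add0r.
  by change (- (2^-1 * (x + x)) = - x); field.
have -> : std_pdf =
  normal_peak 1 \*: (expR \o (fun x : R => - (x ^+ 2 / 2))) by [].
apply: is_derive_eq; rewrite /std_pdf; set e := expR _.
by change (normal_peak 1 * (e * - x) = - x * (normal_peak 1 * e)); ring.
Qed.

Lemma is_derive_Nid_std_pdf x :
  is_derive x 1 (fun x => - x * std_pdf x) ((x ^+ 2 - 1) * std_pdf x).
Proof.
have D := is_derive_std_pdf x.
have -> : (fun x => - x * std_pdf x) = (fun x => - x) * std_pdf by [].
apply: is_derive_eq; set p := std_pdf x.
by change (- x * (- x * p) + p * - 1 = (x ^+ 2 - 1) * p); ring.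
Qed.

(** With [u = x ^+ 2 / 2], [1 + u <= expR u] and [|x ^+ 2 - 1| <= 2 * (1 + u)], so the exponential
    absorbs the polynomial factor. *)
Lemma std_pdf_second_derivative_bound x :
  `|(x ^+ 2 - 1) * std_pdf x| <= 2 * normal_peak 1.
Proof.
rewrite normrM (ger0_norm (std_pdf_ge0 x)).
have e0 := expR_gt0 (- (x ^+ 2 / 2)); have p0 := normal_peak_ge0 (1 : R).
rewrite /std_pdf mulrCA mulrC ler_wpM2r//.
have h : (1 + x ^+ 2 / 2) * expR (- (x ^+ 2 / 2)) <= 1.
  by rewrite expRN ler_pdivrMr ?expR_gt0// mul1r expR_ge1Dx.
have : `|x ^+ 2 - 1| <= 2 * (1 + x ^+ 2 / 2).
  rewrite (le_trans (ler_normB _ _))// normr1 ger0_norm ?sqr_ge0//.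
  have := sqr_ge0 x; lra.
move=> /(ler_wpM2r (ltW e0)) /le_trans; apply; lra.
Qed.

(** The sign of [d] is arbitrary, so the intermediate point is located by its distance to [x] rather
    than by an interval. *)
Lemma MVT_norm (f df : R -> R) x d :
  (forall z, is_derive z 1 f (df z)) ->
  exists2 z, `|z - x| <= `|d| & f (x + d) - f x = df z * d.
Proof.
move=> fdf.
have cf a b : {within `[a, b], continuous f}.
  by apply: derivable_within_continuous => z _; have [] := fdf z.
have [d0|d0] := leP 0 d.
  have xd : x <= x + d by rewrite lerDl.
  have [z] := MVT_segment xd (fun z _ => fdf z) (cf _ _).
  rewrite in_itv/= => /andP[xz zd]; rewrite (addrC x d) addrK => ->.
  exists z => //; rewrite !ger0_norm ?subr_ge0//; lra.
have dx : x + d <= x by rewrite gerDl ltW.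
have [z] := MVT_segment dx (fun z _ => fdf z) (cf _ _).
rewrite in_itv/= => /andP[xz zd] h.
exists z; last by rewrite -opprB h; ring.
rewrite ler0_norm ?subr_le0// ltr0_norm//; lra.
Qed.

Lemma std_pdf_derivative_lipschitz z d :
  `|- (z + d) * std_pdf (z + d) - (- z * std_pdf z)| <=
    2 * normal_peak 1 * `|d|.
Proof.
have [w _ ->] := MVT_norm z d is_derive_Nid_std_pdf.
by rewrite normrM ler_wpM2r// std_pdf_second_derivative_bound.
Qed.

(** The mean value theorem turns the remainder into [d] times the change of the derivative between
    [z] and a point within [|d|] of it; the Lipschitz bound gives the second factor [|d|]. *)
Lemma std_pdf_taylor z d :
  `|std_pdf (z + d) - std_pdf z - d * (- z * std_pdf z)| <=
    2 * normal_peak 1 * d ^+ 2.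
Proof.
have [w wz ->] := MVT_norm z d is_derive_std_pdf.
have := std_pdf_derivative_lipschitz z (w - z).
rewrite [z + _]addrC subrK => h.
rewrite [X in X - _]mulrC -mulrBr normrM -(real_normK (num_real d)).
rewrite expr2 [leRHS]mulrCA ler_wpM2l// (le_trans h)// ler_wpM2l// mulr_ge0//.
exact: normal_peak_ge0.
Qed.

End std_normal.

(** * Limits of the standard normal distribution function at infinity *)

Section std_cdf_limits.
Context {R : realType}.

(** Under the normal law the identity is a random variable with distribution function [std_cdf], so
    general limits of [cdf] apply. *)
Let idTR : measurableTypeR R -> R := idfun.

#[local] HB.instance Definition _ :=
  @isMeasurableFun.Build _ _ _ _ idTR (@measurable_id _ _ setT).

Lemma std_cdf_cvgy : std_cdf x @[x --> +oo] --> (1 : R).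
Proof. exact/fine_cvg/(cvg_cdfy1 (idTR : {RV (normal_prob 0 1) >-> R})). Qed.

Lemma std_cdf_cvgNy : std_cdf x @[x --> -oo] --> (0 : R).
Proof. exact/fine_cvg/(cvg_cdfNy0 (idTR : {RV (normal_prob 0 1) >-> R})). Qed.

End std_cdf_limits.

(** * One replacement step along the heat equation *)

Section heat_path.
Context {R : realType}.
Implicit Types y e s t c T : R.

Let is_derive_sqrt_inv T s : s ^+ 2 < T ->
  is_derive s 1 (fun s => (Num.sqrt (T - s ^+ 2))^-1)
    (s * (Num.sqrt (T - s ^+ 2))^-1 ^+ 3).
Proof.
move=> sT; have h0 : 0 < T - s ^+ 2 by rewrite subr_gt0.
have q0 : Num.sqrt (T - s ^+ 2) != 0 by rewrite gt_eqF// sqrtr_gt0.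
have D1 : is_derive s 1 (fun s : R => T - s ^+ 2) (- (2 * s)).
  apply: is_derive_eq.
  by change ((0 + 1) * - (s * 1 + s * 1) = - (2 * s)); ring.
have D2 := is_derive1_comp (f := Num.sqrt) (g := fun s : R => T - s ^+ 2)
  (is_derive1_sqrt h0) D1.
have D3 := is_deriveV (f := Num.sqrt \o (fun s : R => T - s ^+ 2)) q0 D2.
apply: (is_derive_eq D3); move: q0; rewrite /comp; set q := Num.sqrt _ => q0.
by change (- q ^- 2 * ((2 * q)^-1 * (- (2 * s))) = s * q^-1 ^+ 3); field.
Qed.

(** The path joins the two sides of a replacement: at [s = 0] all the variance [T] is Gaussian, and
    at [s] the part [s * e] has taken over [s ^+ 2] of it. The first term of the derivative comes
    from the variance, the second from the shift. *)
Lemma is_derive_std_cdf_path T y e s : s ^+ 2 < T ->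
  let r := (Num.sqrt (T - s ^+ 2))^-1 in let z := (y - s * e) * r in
  is_derive s 1 (fun s => std_cdf ((y - s * e) / Num.sqrt (T - s ^+ 2)))
    (- (s * r ^+ 2 * (- z * std_pdf z)) - e * r * std_pdf z).
Proof.
move=> sT r z; have D1 := is_derive_sqrt_inv sT.
have D2 : is_derive s 1 (fun s => y - s * e) (- e).
  apply: is_derive_eq.
  by change ((0 + 1) * - (s * 0 + e * 1) = - e); ring.
have D3 := is_deriveM D2 D1.
have D4 := is_derive1_comp (f := std_cdf)
  (g := fun s => (y - s * e) * (Num.sqrt (T - s ^+ 2))^-1)
  (is_derive_std_cdf _) D3.
apply: (is_derive_eq D4); rewrite -/r.
set p := std_pdf z.
change (p * ((y - s * e) * (s * r ^+ 3) + r * - e) =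
  - (s * r ^+ 2 * (- z * p)) - e * r * p).
rewrite /z; ring.
Qed.

(* The time derivative of [std_cdf (y / sqrt t)] is half its second space
   derivative, so along the path the terms of order 0 and 1 in [s] of the
   derivative cancel when the [eta i] have mean 0 and variance 1. *)
Lemma sum_std_cdf_path_derivative_bound n (eta z : 'I_n -> R) c rho r y s :
  \sum_i eta i = 0 -> \sum_i eta i ^+ 2 = n%:R -> (forall i, `|eta i| <= c) ->
  0 <= c -> 0 <= s -> 0 <= r <= rho -> (forall i, z i = (y - s * eta i) * r) ->
  `|\sum_(i < n) (- (s * r ^+ 2 * (- z i * std_pdf (z i)))
                  - eta i * r * std_pdf (z i))| <=
    n%:R * (2 * normal_peak 1 * (c + c ^+ 3) * rho ^+ 3) * s ^+ 2.
Proof.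
move=> eta1 eta2 etac c0 s0 /andP[r0 rrho] z_def.
pose z0 := y * r; pose M : R := 2 * normal_peak 1.
have M0 : 0 <= M by rewrite mulr_ge0// normal_peak_ge0.
have r3 : r ^+ 3 <= rho ^+ 3 by rewrite lerXn2r// nnegrE (le_trans r0).
pose d i := - (r * s * eta i).
have zE i : z i = z0 + d i by rewrite z_def /z0 /d; ring.
(* [z0] does not depend on [i], so the moment conditions cancel the expansion there. What is left is
   [e1], of order [d i ^+ 2] and source of [c ^+ 3], and [e2], of order [d i] and source of [c]. *)
pose e1 i := std_pdf (z i) - std_pdf z0 - d i * (- z0 * std_pdf z0).
pose e2 i := - z i * std_pdf (z i) - (- z0 * std_pdf z0).
have -> : \sum_(i < n) (- (s * r ^+ 2 * (- z i * std_pdf (z i)))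
    - eta i * r * std_pdf (z i)) =
    \sum_(i < n) (- (s * r ^+ 2 * e2 i) - eta i * r * e1 i).
  apply/eqP; rewrite -subr_eq0 -sumrB; apply/eqP.
  rewrite (eq_bigr (fun i => - (s * r ^+ 2 * (- z0 * std_pdf z0)) +
      - (r * std_pdf z0) * eta i +
      s * r ^+ 2 * (- z0 * std_pdf z0) * eta i ^+ 2)); last first.
    by move=> i _; rewrite /e1 /e2 /d; ring.
  rewrite !big_split/= -!mulr_sumr eta1 eta2 sumr_const card_ord -mulr_natl.
  by ring.
have bound i : `|- (s * r ^+ 2 * e2 i) - eta i * r * e1 i| <=
    M * (c + c ^+ 3) * r ^+ 3 * s ^+ 2.
  have dE : `|d i| = r * s * `|eta i|.
    by rewrite normrN !normrM (ger0_norm r0) (ger0_norm s0).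
  have dc : `|d i| <= r * s * c by rewrite dE ler_wpM2l// mulr_ge0.
  have he2 : `|e2 i| <= M * (r * s * c).
    by rewrite /e2 zE (le_trans (std_pdf_derivative_lipschitz _ _))// ler_wpM2l.
  have he1 : `|e1 i| <= M * (r * s * c) ^+ 2.
    rewrite /e1 zE (le_trans (std_pdf_taylor _ _))// ler_wpM2l//.
    rewrite -(real_normK (num_real (d i))) lerXn2r// nnegrE.
    by rewrite mulr_ge0// mulr_ge0.
  have sr0 : 0 <= s * r ^+ 2 by rewrite mulr_ge0// exprn_ge0.
  rewrite (le_trans (ler_normB _ _))// normrN normrM (ger0_norm sr0).
  rewrite [`|_ * e1 i|]normrM [`|eta i * r|]normrM (ger0_norm r0).
  have : s * r ^+ 2 * `|e2 i| <= s * r ^+ 2 * (M * (r * s * c)).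
    by rewrite ler_wpM2l.
  have : `|eta i| * r * `|e1 i| <= c * r * (M * (r * s * c) ^+ 2).
    by rewrite ler_pM// ?mulr_ge0// ler_wpM2r.
  move=> h1 h2; apply: (le_trans (lerD h2 h1)).
  by rewrite le_eqVlt; apply/orP; left; apply/eqP; ring.
apply: (le_trans (ler_norm_sum _ _ _)).
apply: (le_trans (ler_sum _ (fun i _ => bound i))).
rewrite sumr_const card_ord -[leLHS]mulr_natl -[leRHS]mulrA ler_wpM2l//.
by rewrite ler_wpM2r ?sqr_ge0// ler_wpM2l// mulr_ge0// addr_ge0// exprn_ge0.
Qed.

(** Apply the mean value theorem on [[0, s]] to the path with total variance [T = t + s ^+ 2]: a
    derivative of order [w ^+ 2] over a length [s] gives [s ^+ 3]. *)
Lemma std_cdf_one_step n (eta : 'I_n -> R) c t y s :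
  \sum_i eta i = 0 -> \sum_i eta i ^+ 2 = n%:R -> (forall i, `|eta i| <= c) ->
  0 <= c -> 0 < t -> 0 <= s ->
  `|\sum_(i < n) std_cdf ((y - s * eta i) / Num.sqrt t) -
    n%:R * std_cdf (y / Num.sqrt (t + s ^+ 2))| <=
    n%:R * (2 * normal_peak 1 * (c + c ^+ 3) / Num.sqrt t ^+ 3) * s ^+ 3.
Proof.
move=> eta1 eta2 etac c0 t0 s0.
pose T := t + s ^+ 2.
pose r w := (Num.sqrt (T - w ^+ 2))^-1.
pose z w i := (y - w * eta i) * r w.
pose f i w := std_cdf ((y - w * eta i) / Num.sqrt (T - w ^+ 2)).
pose df i w := - (w * r w ^+ 2 * (- z w i * std_pdf (z w i)))
               - eta i * r w * std_pdf (z w i).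
(* The Gaussian variance never drops below [t], which bounds [r w] uniformly by the inverse of
   [Num.sqrt t]. *)
have ws w : w \in `[0, s] -> t <= T - w ^+ 2.
  rewrite in_itv/= => /andP[w0 ws]; rewrite /T -addrA lerDl subr_ge0.
  by rewrite lerXn2r// nnegrE.
have dF w : w \in `[0, s] ->
    is_derive w 1 (\sum_(i < n) f i) (\sum_(i < n) df i w).
  move=> /ws tw; apply: is_derive_sum => i.
  by apply: is_derive_std_cdf_path; rewrite -subr_gt0 (lt_le_trans t0).
have dF' w : w \in `]0, s[ ->
    is_derive w 1 (\sum_(i < n) f i) (\sum_(i < n) df i w).
  by move=> /subset_itv_oo_cc; exact: dF.
have cF : {within `[0, s], continuous (\sum_(i < n) f i)}.
  by apply: derivable_within_continuous => w /dF [].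
have [w ws0] := MVT_segment s0 dF' cF.
rewrite !fct_sumE /f subr0.
under eq_bigr do rewrite {1}/T addrK.
under [X in _ - X = _]eq_bigr do rewrite mul0r subr0 expr0n subr0.
rewrite sumr_const card_ord -[X in _ - X = _]mulr_natl => ->.
rewrite [s ^+ 3]exprSr [leRHS]mulrA normrM (ger0_norm s0) ler_wpM2r//.
have [w0 wls] : 0 <= w /\ w <= s by move: ws0; rewrite in_itv/= => /andP[].
have st0 : 0 < Num.sqrt t by rewrite sqrtr_gt0.
apply: (@le_trans _ _ (n%:R *
    (2 * normal_peak 1 * (c + c ^+ 3) / Num.sqrt t ^+ 3) * w ^+ 2)); last first.
  rewrite ler_wpM2l ?lerXn2r ?nnegrE// mulr_ge0//.
  rewrite divr_ge0 ?exprn_ge0 ?sqrtr_ge0// mulr_ge0 ?addr_ge0 ?exprn_ge0//.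
  by rewrite mulr_ge0// normal_peak_ge0.
rewrite -exprVn.
apply: (@sum_std_cdf_path_derivative_bound _ _ _ _ _ (r w) y) => //.
have := ws _ ws0; rewrite invr_ge0 sqrtr_ge0/= => tw.
by rewrite lef_pV2 ?posrE ?ler_wsqrtr// sqrtr_gt0 (lt_le_trans t0).
Qed.

End heat_path.

(** * Sums over tuples and replacement of all the parts *)

Section tuples.

Lemma big_tuple_cons (V : nmodType) (I : finType) k (F : k.+1.-tuple I -> V) :
  \sum_p F p = \sum_i \sum_p F (cons_tuple i p).
Proof.
rewrite pair_big/= (reindex (fun q : I * k.-tuple I => cons_tuple q.1 q.2))//=.
exists (fun p : k.+1.-tuple I => (thead p, [tuple of behead p])) => /=.
  by move=> [i p] _/=; congr pair; apply/val_inj.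
by move=> p _; rewrite [in RHS](tuple_eta p); apply/val_inj.
Qed.

Lemma sum_tnth_cons (V : nmodType) (I : finType) k (g : I -> V) i
    (p : k.-tuple I) :
  \sum_(j < k.+1) g (tnth (cons_tuple i p) j) = g i + \sum_(j < k) g (tnth p j).
Proof.
rewrite big_ord_recl; congr +%R.
by apply: eq_bigr => j _; rewrite !(tnth_nth i).
Qed.

End tuples.

(* The telescoping sum of Lindeberg's argument: the summands are replaced one
   at a time by Gaussian smoothing of the same variance [s ^+ 2]. *)
Lemma std_cdf_sum_tuple (R : realType) n k (eta : 'I_n -> R) c t y s :
  \sum_i eta i = 0 -> \sum_i eta i ^+ 2 = n%:R -> (forall i, `|eta i| <= c) ->
  0 <= c -> 0 < t -> 0 <= s ->
  `|\sum_(p : k.-tuple 'I_n)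
      std_cdf ((y - s * \sum_j eta (tnth p j)) / Num.sqrt t) -
    n%:R ^+ k * std_cdf (y / Num.sqrt (t + k%:R * s ^+ 2))| <=
  n%:R ^+ k *
    (k%:R * (2 * normal_peak 1 * (c + c ^+ 3) / Num.sqrt t ^+ 3 * s ^+ 3)).
Proof.
move=> eta1 eta2 etac c0 t0 s0.
set K : R := 2 * normal_peak 1 * (c + c ^+ 3) / Num.sqrt t ^+ 3.
elim: k y => [|k IH] y.
  under eq_bigr do rewrite big_ord0 mulr0 subr0.
  rewrite sumr_const card_tuple expn0 mulr1n.
  by rewrite expr0 !mul1r !mul0r addr0 subrr normr0.
rewrite big_tuple_cons.
under eq_bigr do under eq_bigr do rewrite sum_tnth_cons mulrDr opprD addrA.
(* For each head [i], the induction hypothesis at [y - s * eta i] trades the tail for variance,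
   reaching [t']; one step from [t'] then trades the head. *)
pose t' := t + k%:R * s ^+ 2.
have tt' : t <= t' by rewrite lerDl mulr_ge0// sqr_ge0.
have t'0 : 0 < t' by rewrite (lt_le_trans t0).
have := @std_cdf_one_step _ _ eta c t' y s eta1 eta2 etac c0 t'0 s0.
set K' : R := _ / Num.sqrt t' ^+ 3.
(* More smoothing means a smaller constant, so the constant at [t] serves for every step. *)
have K'K : K' <= K.
  rewrite /K' /K ler_wpM2l//.
    by rewrite mulr_ge0 ?addr_ge0 ?exprn_ge0// mulr_ge0// normal_peak_ge0.
  rewrite lef_pV2 ?posrE ?exprn_gt0 ?sqrtr_gt0//.
  by rewrite lerXn2r ?nnegrE ?sqrtr_ge0// ler_wsqrtr.
set A := \sum_(i < n) _; set B := std_cdf _ => hA.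
have {}hA : `|A - n%:R * B| <= n%:R * (K * s ^+ 3).
  by rewrite (le_trans hA)// -mulrA ler_wpM2l// ler_wpM2r// exprn_ge0.
have -> : t + k.+1%:R * s ^+ 2 = t' + s ^+ 2 by rewrite /t' -natr1; ring.
rewrite -/B.
set S := \sum_(i < n) _.
have hS : `|S - n%:R ^+ k * A| <= n%:R * (n%:R ^+ k * (k%:R * (K * s ^+ 3))).
  rewrite /S /A mulr_sumr -sumrB (le_trans (ler_norm_sum _ _ _))//.
  rewrite (le_trans (ler_sum _ (fun i _ => IH (y - s * eta i))))//.
  by rewrite sumr_const card_ord -[leLHS]mulr_natl.
have -> : S - n%:R ^+ k.+1 * B =
    (S - n%:R ^+ k * A) + n%:R ^+ k * (A - n%:R * B) by rewrite exprS; ring.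
rewrite (le_trans (ler_normD _ _))// normrM [`|_ ^+ _|]ger0_norm ?exprn_ge0//.
have := ler_wpM2l (exprn_ge0 k (ler0n R n)) hA.
move=> /(lerD hS) /le_trans; apply.
rewrite le_eqVlt; apply/orP; left; apply/eqP.
by rewrite -[k.+1%:R]natr1 [n%:R ^+ k.+1]exprS; ring.
Qed.

(** * Moments of a standardized uniform part *)

Section uniform_parts.
Context {R : realType}.

Definition std_part (l : nat) (j : 'I_l.+1) : R := (j%:R - l%:R / 2) / sigma l.

Lemma sum_ord_natr n : \sum_(j < n.+1) (j%:R : R) = n%:R * n.+1%:R / 2.
Proof.
elim: n => [|n IH]; first by rewrite big_ord_recl big_ord0 !mul0r addr0.
by rewrite big_ord_recr/= IH -!natr1; field.
Qed.

Lemma sum_ord_natr_sqr n :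
  \sum_(j < n.+1) (j%:R ^+ 2 : R) = n%:R * n.+1%:R * (2 * n%:R + 1) / 6.
Proof.
elim: n => [|n IH]; first by rewrite big_ord_recl big_ord0 expr0n !mul0r addr0.
by rewrite big_ord_recr/= IH -!natr1; field.
Qed.

Lemma sigma_sqr l : sigma l ^+ 2 = (l%:R ^+ 2 + 2 * l%:R) / 12 :> R.
Proof.
rewrite sqr_sqrtr -natr1; first by congr (_ / _); ring.
have := ler0n R l; nra.
Qed.

Lemma sigma_gt0 l : (1 <= l)%N -> 0 < sigma l :> R.
Proof.
rewrite -(ler1n R) => l1; rewrite sqrtr_gt0 -natr1; nra.
Qed.

Lemma sum_std_part l : \sum_(j < l.+1) std_part j = 0.
Proof.
rewrite -mulr_suml sumrB sum_ord_natr sumr_const card_ord.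
by rewrite -[X in _ - X]mulr_natl [l.+1%:R * _]mulrC mulrAC subrr mul0r.
Qed.

Lemma sum_std_part_sqr l : (1 <= l)%N ->
  \sum_(j < l.+1) std_part j ^+ 2 = l.+1%:R.
Proof.
move=> l1; have s0 := sigma_gt0 l1.
rewrite (eq_bigr (fun j : 'I_l.+1 =>
    (sigma l ^+ 2)^-1 * j%:R ^+ 2 - ((sigma l ^+ 2)^-1 * l%:R) * j%:R +
    (sigma l ^+ 2)^-1 * (l%:R ^+ 2 / 4))); last first.
  by move=> j _; rewrite /std_part; field; rewrite gt_eqF.
rewrite big_split/= sumrB -!mulr_sumr sum_ord_natr_sqr sum_ord_natr sumr_const.
rewrite card_ord -[4^-1 *+ _]mulr_natl sigma_sqr -!natr1.
move: l1; rewrite -(ler1n R) => l1.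
by field; rewrite gt_eqF//; nra.
Qed.

(** The deviation is at most [l / 2] and the variance at least [l ^+ 2 / 12], so the ratio is below
    the square root of 3. Uniformity in [l] makes the Lindeberg error depend on [m] and [eps]
    only. *)
Lemma norm_std_part_le2 l j : (1 <= l)%N -> `|std_part (j : 'I_l.+1)| <= 2.
Proof.
move=> l1; have s0 := sigma_gt0 l1.
rewrite normrM normfV (gtr0_norm s0) ler_pdivrMr//.
rewrite -(@ler_pXn2r _ 2)// ?nnegrE ?mulr_ge0// ?ltW//.
rewrite real_normK ?num_real// exprMn sigma_sqr.
have jl : (j%:R : R) <= l%:R by rewrite ler_nat -ltnS.
have j0 := ler0n R j.
move: l1; rewrite -(ler1n R) => l1; nra.
Qed.

End uniform_parts.

(** * The distribution function for exactly [m] parts *)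

Section composition_cdf.
Context {R : realType}.

Definition std_value (l m n : nat) : R :=
  (n%:R - m%:R * l%:R / 2) / (sigma l * Num.sqrt m%:R).

(** The distribution function of the standardized sum of [m] independent uniform parts, written as a
    proportion of tuples so that no probability space is built. *)
Definition fixed_parts_cdf (l m : nat) (x : R) : R :=
  (\sum_(p : m.-tuple 'I_l.+1)
     (std_value l m (\sum_j tnth p j) <= x)%R%:R) / l.+1%:R ^+ m.

Lemma std_value_sum l m (p : m.-tuple 'I_l.+1) : (1 <= l)%N -> (1 <= m)%N ->
  std_value l m (\sum_j tnth p j) =
  (Num.sqrt m%:R)^-1 * \sum_j std_part (tnth p j).
Proof.
move=> l1 m1; have s0 : sigma l != 0 :> R by rewrite gt_eqF// sigma_gt0.
have q0 : Num.sqrt m%:R != 0 :> R by rewrite gt_eqF// sqrtr_gt0 ltr0n.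
rewrite -mulr_suml sumrB -natr_sum sumr_const card_ord -[_ / 2 *+ m]mulr_natl.
by rewrite /std_value; field; rewrite s0.
Qed.

(* The constant of [std_cdf_sum_tuple] for the bound [`|std_part j| <= 2]. *)
Definition lindeberg_error (eps : R) : R :=
  2 * normal_peak 1 * (2 + 2 ^+ 3) / Num.sqrt eps ^+ 3.

(** With [s] the inverse of [Num.sqrt m%:R], the [m] steps add variance exactly 1, and
    [m * s ^+ 3 = s]. *)
Lemma smoothed_cdf_error l m eps y : (1 <= l)%N -> (1 <= m)%N -> 0 < eps ->
  `|(\sum_(p : m.-tuple 'I_l.+1)
      std_cdf ((y - std_value l m (\sum_j tnth p j)) / Num.sqrt eps)) /
      l.+1%:R ^+ m - std_cdf (y / Num.sqrt (eps + 1))| <=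
  lindeberg_error eps / Num.sqrt m%:R.
Proof.
move=> l1 m1 eps0; set s : R := (Num.sqrt m%:R)^-1.
have m0 : 0 < m%:R :> R by rewrite ltr0n.
have s0 : 0 <= s by rewrite invr_ge0 sqrtr_ge0.
have ms : m%:R * s ^+ 2 = 1.
  by rewrite /s exprVn sqr_sqrtr ?ltW// mulfV// gt_eqF.
have N0 : 0 < l.+1%:R ^+ m :> R by rewrite exprn_gt0// ltr0n.
have := @std_cdf_sum_tuple R l.+1 m (@std_part R l) 2 eps y s (sum_std_part l)
  (sum_std_part_sqr l1) (fun j => norm_std_part_le2 j l1) (ler0n _ 2) eps0 s0.
rewrite ms -/(lindeberg_error eps).
under eq_bigr do rewrite -std_value_sum//.
set S := \sum_(p : _) _; set B := std_cdf _ => h.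
rewrite (_ : S / _ - B = (S - l.+1%:R ^+ m * B) / l.+1%:R ^+ m); last first.
  by rewrite mulrBl mulrAC mulfV ?mul1r ?gt_eqF.
rewrite normrM normfV (gtr0_norm N0) ler_pdivrMr// (le_trans h)//.
rewrite [leRHS]mulrC ler_wpM2l ?(ltW N0)//.
have -> : m%:R * (lindeberg_error eps * s ^+ 3) =
  (m%:R * s ^+ 2) * (lindeberg_error eps * s) by ring.
by rewrite ms mul1r.
Qed.

(** Shifting the smooth step right by [dlt] nearly dominates the indicator of [w <= x]: on that
    half-line it is at least [std_cdf (dlt / Num.sqrt eps)], and elsewhere it is nonnegative. *)
Lemma fixed_parts_cdf_le l m eps dlt x :
  (1 <= l)%N -> (1 <= m)%N -> 0 < eps ->
  fixed_parts_cdf l m x <= std_cdf ((x + dlt) / Num.sqrt (eps + 1)) +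
    lindeberg_error eps / Num.sqrt m%:R + (1 - std_cdf (dlt / Num.sqrt eps)).
Proof.
move=> l1 m1 eps0.
have N0 : 0 < l.+1%:R ^+ m :> R by rewrite exprn_gt0// ltr0n.
have := smoothed_cdf_error (x + dlt) l1 m1 eps0.
set S := \sum_(p : _) _; set B := std_cdf _.
have : fixed_parts_cdf l m x <=
    S / l.+1%:R ^+ m + (1 - std_cdf (dlt / Num.sqrt eps)).
  rewrite /fixed_parts_cdf ler_pdivrMr// mulrDl divfK ?gt_eqF// -lerBlDl -sumrB.
  (* The power of [l.+1] becomes a sum over tuples, so the comparison can be made termwise. *)
  rewrite -natrX -[in leRHS](card_ord l.+1) -card_tuple mulr_natr -sumr_const.
  apply: ler_sum => p _; case: (leP (std_value l m _) x) => [wx|_].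
    rewrite /= lerD2l lerN2 std_cdf_nd// ler_wpM2r ?invr_ge0 ?sqrtr_ge0//; lra.
  rewrite /=; have := std_cdf_ge0
    ((x + dlt - std_value l m (\sum_j tnth p j)) / Num.sqrt eps).
  have := std_cdf_le1 (dlt / Num.sqrt eps); lra.
rewrite ler_norml => h /andP[_]; lra.
Qed.

(** The mirror image: the step shifted left by [dlt] is at most [std_cdf (- dlt / Num.sqrt eps)]
    beyond [x], and at most 1 elsewhere. *)
Lemma fixed_parts_cdf_ge l m eps dlt x :
  (1 <= l)%N -> (1 <= m)%N -> 0 < eps ->
  std_cdf ((x - dlt) / Num.sqrt (eps + 1)) -
    lindeberg_error eps / Num.sqrt m%:R - std_cdf (- dlt / Num.sqrt eps) <=
  fixed_parts_cdf l m x.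
Proof.
move=> l1 m1 eps0.
have N0 : 0 < l.+1%:R ^+ m :> R by rewrite exprn_gt0// ltr0n.
have := smoothed_cdf_error (x - dlt) l1 m1 eps0.
set S := \sum_(p : _) _; set B := std_cdf _.
have : S / l.+1%:R ^+ m - std_cdf (- dlt / Num.sqrt eps) <=
    fixed_parts_cdf l m x.
  rewrite /fixed_parts_cdf ler_pdivlMr// mulrBl divfK ?gt_eqF//.
  rewrite lerBlDr -lerBlDl -sumrB.
  rewrite -natrX -[in leRHS](card_ord l.+1) -card_tuple mulr_natr -sumr_const.
  apply: ler_sum => p _; case: (leP (std_value l m _) x) => [_|wx].
    rewrite /=; have := std_cdf_le1
      ((x - dlt - std_value l m (\sum_j tnth p j)) / Num.sqrt eps).
    have := std_cdf_ge0 (- dlt / Num.sqrt eps); lra.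
  rewrite /= subr0 std_cdf_nd// ler_wpM2r ?invr_ge0 ?sqrtr_ge0//; lra.
rewrite ler_norml => h /andP[]; lra.
Qed.

(** First fix [M] with normal tails at most [e] beyond it, then tie the parameters by
    [eps = (dlt / M) ^+ 2]. The tail arguments stay at [M] and [- M] while [dlt] shrinks, and
    continuity at [x] gives the other two bounds. *)
Lemma std_cdf_approx x e : 0 < e -> exists2 eps : R, 0 < eps &
  exists dlt : R,
  [/\ std_cdf ((x + dlt) / Num.sqrt (eps + 1)) <= std_cdf x + e,
      std_cdf x - e <= std_cdf ((x - dlt) / Num.sqrt (eps + 1)),
      1 - e <= std_cdf (dlt / Num.sqrt eps) &
      std_cdf (- dlt / Num.sqrt eps) <= e].
Proof.
move=> e0.
have [M M0 [M1 M2]] : exists2 M : R, 0 < M &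
    1 - e <= std_cdf M /\ std_cdf (- M) <= e.
  have /cvgrPdist_le /(_ _ e0) hy := @std_cdf_cvgy R.
  have hN : std_cdf (- M) @[M --> +oo] --> (0 : R).
    by apply: (cvg_comp -%R std_cdf _ std_cdf_cvgNy); rewrite ninfty.
  move/cvgrPdist_le : hN => /(_ _ e0) hNy.
  near (pinfty_nbhs R) => M; exists M.
    by near: M; exact: nbhs_pinfty_gt.
  split.
    have : `|1 - std_cdf M| <= e by near: M.
    by rewrite ler_norml => /andP[_]; lra.
  have : `|0 - std_cdf (- M)| <= e by near: M.
  by rewrite sub0r normrN ler_norml => /andP[_].
(* The variance is even in [d], so one limit at 0 covers the shifts by [dlt] and by [- dlt]. *)
pose h d := std_cdf ((x + d) / Num.sqrt ((d / M) ^+ 2 + 1)).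
have h0 : h d @[d --> (0 : R)] --> std_cdf x.
  have c1 : x + d @[d --> (0 : R)] --> x + 0 by exact: cvgD (cvg_cst _) cvg_id.
  have c2 : d / M @[d --> (0 : R)] --> 0 / M by exact: cvgM cvg_id (cvg_cst _).
  have c3 : (d / M) ^+ 2 + 1 @[d --> (0 : R)] --> 0 / M * (0 / M) + 1.
    exact: cvgD (cvgM c2 c2) (cvg_cst _).
  have v1 : Num.sqrt (0 / M * (0 / M) + 1) = 1 by rewrite !mul0r add0r sqrtr1.
  have c4 : Num.sqrt ((d / M) ^+ 2 + 1) @[d --> (0 : R)] --> (1 : R).
    by rewrite -[in X in _ --> X]v1; exact: cvg_comp c3 (@sqrt_continuous R _).
  have c5 : (x + d) / Num.sqrt ((d / M) ^+ 2 + 1) @[d --> (0 : R)] -->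
      (x + 0) / 1.
    exact: cvgM c1 (cvgV (oner_neq0 R) c4).
  have := cvg_comp _ _ c5 (@continuous_std_cdf R _).
  by rewrite addr0 invr1 mulr1.
have /cvgrPdist_le /(_ _ e0) [r/= r0 hr] := h0.
have r2 : 0 < r / 2 by rewrite divr_gt0.
have hp d : `|d| < r -> `|std_cdf x - h d| <= e.
  by move=> dr; apply: hr; rewrite /ball_/= sub0r normrN.
have dM : Num.sqrt ((r / 2 / M) ^+ 2) = r / 2 / M.
  by rewrite sqrtr_sqr ger0_norm// divr_ge0// ltW.
exists ((r / 2 / M) ^+ 2); first by rewrite exprn_gt0// divr_gt0.
exists (r / 2).
have r2M : r / 2 / (r / 2 / M) = M.
  by field; rewrite !gt_eqF.
rewrite dM mulNr r2M; split=> //.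
- have : `|r / 2| < r by rewrite gtr0_norm//; lra.
  by move/hp; rewrite ler_norml => /andP[]; rewrite /h; lra.
- have : `|- (r / 2)| < r by rewrite normrN gtr0_norm//; lra.
  by move/hp; rewrite ler_norml /h mulNr sqrrN => /andP[_]; lra.
Unshelve. all: by end_near. Qed.

End composition_cdf.

(** * Laws carried by finitely many integers *)

Section finite_support.
Context {R : realType} {d} {T : measurableType d} {P : probability T R}.

(** [X] is not assumed integer valued: the atoms have total mass 1, so their complement is null and
    [A] can be cut down to the atoms it contains. *)
Lemma preimage_sum_pmf (X : {RV P >-> R}) (N : nat) (A : set R) : measurable A ->
  \sum_(i < N) pmf X i%:R = 1 ->
  P (X @^-1` A) = (\sum_(i < N) `[< A i%:R >]%:R * pmf X i%:R)%:E.
Proof.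
move=> mA sum1.
pose mu : probability _ R := distribution P X.
pose F (i : 'I_N) : set R := [set i%:R].
have mF i : measurable (F i) by exact: measurable_set1.
have tF : trivIset setT F.
  by move=> i j _ _ [r [-> /eqP]]; rewrite eqr_nat => /eqP/val_inj.
have muF i : mu (F i) = (pmf X i%:R)%:E.
  by rewrite /pmf fineK// fin_num_measure//; exact: measurable_funPTI.
pose S := \big[setU/set0]_(i < N) F i.
have mS : measurable S by apply: bigsetU_measurable => i _.
have muS : mu S = 1%E.
  rewrite measure_bigsetU_ord// (eq_bigr _ (fun i _ => muF i)).
  by rewrite sumEFin sum1.
have muSC : mu (A `\` S) = 0%E.
  apply: (@subset_measure0 _ _ _ mu _ (~` S)).
  - exact: measurableD.
  - exact: measurableC.
  - by move=> r [].
  - apply: etrans (probability_setC mu mS) _.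
    by rewrite [X in (1 - X)%E]muS subee.
have AS : A `&` S = \big[setU/set0]_(i < N | `[< A i%:R >]) F i.
  rewrite /S big_distrr/= [RHS]big_mkcond/=; apply: eq_bigr => i _.
  case: asboolP => Ai; first by apply/seteqP; split => [r []//|_ ->].
  by apply/seteqP; split => // r [+ rE]; rewrite rE.

change (mu A = (\sum_(i < N) `[< A i%:R >]%:R * pmf X i%:R)%:E).
apply: etrans (measureDI mu mA mS) _.
rewrite [X in (X + _)%E]muSC add0e AS measure_bigsetU_ord//.
rewrite (eq_bigr _ (fun i _ => muF i)) sumEFin big_mkcond/=.
congr (_%:E); apply: eq_bigr => i _.
by case: asboolP; rewrite ?mul1r ?mul0r.
Qed.

End finite_support.

(** * Counting compositions and discarding those with fewer than [m] parts *)

Section compositions.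
Context {R : realType}.

(** Double counting: tuples are grouped by their sum. *)
Lemma sum_num_compositions l m (f : nat -> R) :
  \sum_(i < (l * m).+1) f i * (num_compositions l m i)%:R =
  \sum_(1 <= k < m.+1) \sum_(p : k.-tuple 'I_l.+1) f (\sum_j tnth p j)%N.
Proof.
under eq_bigr do rewrite /num_compositions natr_sum mulr_sumr.
rewrite exchange_big/= big_nat_cond [RHS]big_nat_cond; apply: eq_bigr => k.
rewrite andbT => /andP[_ km].
under eq_bigr do rewrite -sum1_card natr_sum mulr_sumr big_mkcond/=.
rewrite exchange_big/=; apply: eq_bigr => p _.
(* At most [m] parts of size at most [l]: every tuple falls in exactly one group. *)
have pm : (\sum_j tnth p j < (l * m).+1)%N.
  rewrite ltnS (@leq_trans (\sum_(j < k) l))%N//.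
    by apply: leq_sum => j _; rewrite -ltnS.
  by rewrite sum_nat_const card_ord mulnC leq_mul2l -ltnS km orbT.
rewrite (bigD1 (Ordinal pm))//= [X in _ + X]big1 => [|i ip].
  by rewrite addr0 unfold_in/= eqxx mulr1.
rewrite unfold_in/=; case: eqP => // pi; case/eqP: ip; exact/val_inj.
Qed.

Lemma sum_num_compositions1 l m :
  (\sum_(0 <= i < (l * m).+1) num_compositions l m i)%N%:R =
  \sum_(1 <= k < m.+1) l.+1%:R ^+ k :> R.
Proof.
rewrite big_mkord natr_sum.
rewrite (eq_bigr (fun i : 'I_(l * m).+1 => 1 * (num_compositions l m i)%:R)).
  rewrite (sum_num_compositions l m (fun=> 1)); apply: eq_bigr => k _.
  by rewrite sumr_const card_tuple card_ord natrX.
by move=> i _; rewrite mul1r.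
Qed.

(** The induction closes because [n * n.+1 ^ m + n.+1 ^ m = n.+1 ^ m.+1]. *)
Lemma sum_expr_lt n m : (1 <= n)%N ->
  n%:R * \sum_(1 <= k < m) n.+1%:R ^+ k <= n.+1%:R ^+ m :> R.
Proof.
move=> n1; elim: m => [|m IH].
  by rewrite big_geq// mulr0 expr0 ler01.
case: m IH => [|m] IH; first by rewrite big_geq// mulr0 exprn_ge0.
rewrite big_nat_recr//= mulrDr (le_trans (lerD IH (lexx _)))//.
by rewrite [leRHS]exprS -natr1 mulrDl mul1r addrC.
Qed.

(* Compositions with fewer than [m] parts are a fraction at most [1/l] of all. *)
Lemma composition_cdf_error l m x : (1 <= l)%N -> (1 <= m)%N ->
  `|(\sum_(i < (l * m).+1)
       (std_value l m i <= x :> R)%R%:R * (num_compositions l m i)%:R) /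
    (\sum_(0 <= i < (l * m).+1) num_compositions l m i)%N%:R -
    fixed_parts_cdf l m x| <= l%:R^-1.
Proof.
move=> l1 m1.
rewrite sum_num_compositions1.
rewrite (sum_num_compositions l m (fun i => (std_value l m i <= x)%R%:R)).
rewrite /fixed_parts_cdf !(big_nat_recr m)//=.
set a := \sum_(p : _) _; set D := _ ^+ m.
set A := \sum_(1 <= k < m) _; set B := \sum_(1 <= k < m) _.
have D0 : 0 < D by rewrite exprn_gt0// ltr0n.
have l0 : 0 < l%:R :> R by rewrite ltr0n.
have B0 : 0 <= B by apply: sumr_ge0 => k _; rewrite exprn_ge0.
have BD : l%:R * B <= D by exact: sum_expr_lt.
have A0 : 0 <= A.
  by apply: sumr_ge0 => k _; apply: sumr_ge0 => p _; rewrite ler0n.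
have tupb k : \sum_(p : k.-tuple 'I_l.+1)
    (std_value l m (\sum_j tnth p j) <= x :> R)%R%:R <= l.+1%:R ^+ k :> R.
  rewrite -natrX -[in leRHS](card_ord l.+1) -card_tuple -sumr_const.
  by apply: ler_sum => p _; rewrite lern1; case: (_ <= x).
have AB : A <= B by apply: ler_sum => k _; exact: tupb.
have a0 : 0 <= a by apply: sumr_ge0 => p _; rewrite ler0n.
have aD : a <= D by exact: tupb.
have BD0 : 0 < B + D by lra.
(* Since [A <= B] and [a <= D], both products in the numerator lie between 0 and [D * B]; the factor
   [l] then comes from [l * B <= D]. *)
have -> : (A + a) / (B + D) - a / D = (A * D - a * B) / (D * (B + D)).
  by field; rewrite !gt_eqF.
have DBD : 0 < D * (B + D) by rewrite mulr_gt0.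
rewrite normrM normfV (gtr0_norm DBD) ler_pdivrMr// ler_pdivlMl//.
rewrite -[leLHS]mulrC.
have : `|A * D - a * B| <= D * B.
  by rewrite ler_norml; apply/andP; split; nra.
move=> h; nra.
Qed.

End compositions.

(** * The law of the number composed, and the limit theorem *)

Lemma sum_pmf_compositions (R : realType) (l m : nat) (p : R -> R) :
  (forall n, (n <= l * m)%N -> p n%:R = (num_compositions l m n)%:R /
    (\sum_(0 <= i < (l * m).+1) num_compositions l m i)%N%:R) ->
  forall f : nat -> R, \sum_(i < (l * m).+1) f i * p i%:R =
    (\sum_(i < (l * m).+1) f i * (num_compositions l m i)%:R) /
    (\sum_(0 <= i < (l * m).+1) num_compositions l m i)%N%:R.
Proof.
move=> pE f; rewrite mulr_suml; apply: eq_bigr => i _.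
by rewrite pE ?mulrA// -ltnS.
Qed.

Lemma cdf_standardize_compositions (R : realType) d (T : measurableType d)
    (P : probability T R) (X : {RV P >-> R}) (l m : nat) (x : R) :
  (1 <= m)%N ->
  (forall n, (n <= l * m)%N -> pmf X n%:R = (num_compositions l m n)%:R /
    (\sum_(0 <= i < (l * m).+1) num_compositions l m i)%N%:R) ->
  cdf (standardize X (m%:R * l%:R / 2) (sigma l * Num.sqrt m%:R)
    : {RV P >-> R}) x =
  ((\sum_(i < (l * m).+1)
      (std_value l m i <= x :> R)%R%:R * (num_compositions l m i)%:R) /
   (\sum_(0 <= i < (l * m).+1) num_compositions l m i)%N%:R)%:E.
Proof.
move=> m1 pE.
rewrite -(sum_pmf_compositions pE (fun i => (std_value l m i <= x)%R%:R)).
pose g (r : R) := (r - m%:R * l%:R / 2) / (sigma l * Num.sqrt m%:R).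
pose A := g @^-1` `]-oo, x]%classic.
have mA : measurable A.
  have mg : measurable_fun setT g.
    apply: measurable_funM; last exact: measurable_cst.
    by apply: measurable_funB; [exact: measurable_id|exact: measurable_cst].
  by rewrite /A -[_ @^-1` _]setTI; exact: mg.
have sum1 : \sum_(i < (l * m).+1) pmf X i%:R = 1.
  rewrite (eq_bigr (fun i : 'I_(l * m).+1 => 1 * pmf X i%:R)); last first.
    by move=> i _; rewrite mul1r.
  rewrite (sum_pmf_compositions pE (fun=> 1)) big_mkord natr_sum.
  rewrite (eq_bigr (fun i : 'I_(l * m).+1 => (num_compositions l m i)%:R)).
    rewrite divff// -natr_sum -(big_mkord xpredT) sum_num_compositions1.
    (* The total count is positive because [1 <= m] makes the term [k = 1] present. *)
    rewrite gt_eqF//.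
    by rewrite big_nat_recl//= ltr_pwDl ?exprn_gt0 ?ltr0n ?sumr_ge0// => k _.
  by move=> i _; rewrite mul1r.
apply: etrans (preimage_sum_pmf mA sum1) _; congr (_%:E).
apply: eq_bigr => i _; congr (_%:R * _); congr nat_of_bool.
by apply/asboolP/idP; rewrite /A /= in_itv.
Qed.

Theorem theorem1 (R : realType)
    (d : nat -> nat -> measure_display)
    (T : forall l m : nat, measurableType (d l m))
    (P : forall l m : nat, probability (T l m) R)
    (X : forall l m : nat, {RV (P l m) >-> R})
    (X_law : forall l m n : nat, (1 <= l)%N -> (1 <= m)%N -> (n <= l * m)%N ->
      pmf (X l m) n%:R =
        (num_compositions l m n)%:R /
        (\sum_(0 <= i < (l * m).+1) num_compositions l m i)%N%:R) :
  cvg_in_distribution (filter_prod \oo \oo)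
    (fun i : nat * nat =>
       standardize (X i.1 i.2) (i.2%:R * i.1%:R / 2)
         (sigma i.1 * Num.sqrt i.2%:R) : {RV (P i.1 i.2) >-> R})
    (normal_prob 0 1).
Proof.
move=> x _; rewrite [X in _ --> X]std_cdfE; apply: cvg_EFin.
  by apply: nearW => i; rewrite fin_num_measure.
apply/cvgrPdist_le => e e0.
(* Four errors share [e]: short compositions, replacement, shift with extra variance, and tails.
   [eps] and [dlt] are fixed before [l] and [m]. *)
have e3 : 0 < e / 4 by rewrite divr_gt0.
have [eps eps0 [dlt [up lo one zero]]] := std_cdf_approx x e3.
have [L L1 hL] : exists2 L : nat, (1 <= L)%N &
    forall l, (L <= l)%N -> l%:R^-1 <= e / 4.
  exists (Num.truncn (e / 4)^-1).+1 => // l Ll.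
  rewrite -[leRHS]invrK lef_pV2 ?posrE ?invr_gt0//; last first.
    by rewrite ltr0n (leq_trans _ Ll).
  by rewrite (le_trans (ltW (truncnS_gt _)))// ler_nat.
have [M M1 hM] : exists2 M : nat, (1 <= M)%N &
    forall m, (M <= m)%N -> lindeberg_error eps / Num.sqrt m%:R <= e / 4.
  (* The required bound amounts to [q <= Num.sqrt m%:R], which holds once [m] exceeds [q ^+ 2]. *)
  pose q := lindeberg_error eps / (e / 4).
  exists (Num.truncn (q ^+ 2)).+1 => // m Mm.
  have m0 : 0 < m%:R :> R by rewrite ltr0n (leq_trans _ Mm).
  rewrite ler_pdivrMr ?sqrtr_gt0// mulrC -ler_pdivrMr// -/q.
  rewrite (le_trans (ler_norm q))// -sqrtr_sqr ler_wsqrtr//.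
  by rewrite (le_trans (ltW (truncnS_gt _)))// ler_nat.
(* The thresholds are independent of each other, so [l] and [m] may grow at unrelated rates. *)
exists ([set l | (L <= l)%N], [set m | (M <= m)%N]).
  by split; [exists L|exists M].
move=> [l m] [/= Ll Mm].
have l1 := leq_trans L1 Ll; have m1 := leq_trans M1 Mm.
rewrite (cdf_standardize_compositions _ m1 (fun n => X_law l m n l1 m1))/=.
have := composition_cdf_error x l1 m1; set c := _ / _.
have := hL _ Ll; have := hM _ Mm.
have := fixed_parts_cdf_le dlt x l1 m1 eps0.
have := fixed_parts_cdf_ge dlt x l1 m1 eps0.
move: (fixed_parts_cdf l m x) => F hge hle hm hl.
rewrite !ler_norml => /andP[h1 h2]; apply/andP; split; lra.
Qed.
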